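(* Let $\gamma=\gamma(z)$ be a function with $\gamma(1)\ne0$, let $g$ be a function that satisfies $g=e^{z\gamma(g)}$, and let $f=z\dfrac{\gamma(g)}{\gamma(1/g)}$. Then $$B_f=E\circ\overline{\left(\frac{z}{\varepsilon}\right)}\circ\sqrt{z},$$ where $$\varepsilon=\varepsilon(z)=\sqrt{\gamma(e^z)\gamma(e^{-z})},\qquad E(z)=\frac{\gamma(e^z)-\gamma(e^{-z})}{z}.$$
   Context: All power series have real coefficients. The overline denotes compositional inverse of a formal power series of order exactly $1$. The function $\gamma$, not necessarily a generalized palindrome, is understood through its power series expansion at $z=1$, i.e. $\gamma(1+w)\in\mathbb{R}[[w]]$ with nonzero constant term $\gamma(1)$, so that $\gamma(a(z))$ is a formal power series whenever $a(0)=1$; $g$ is a formal power series with $g(0)=1$. The square root defining $\varepsilon$ is the one with positive constant term. The series $E\circ\overline{(z/\varepsilon)}$ is even, so its composition with $\sqrt z$ is a formal power series in $z$. The function $f$ is the pseudo-involutory companion of $g$, i.e. the Riordan array $(g,f)$ is a pseudo-involution: $g\circ(-f)=1/g$ and $-f$ is a compositional involution. The B-function $B_f\in\mathbb{R}[[z]]$ of $f$ is defined by $f-z=zf\,B_f(zf)$, i.e. $f-z=(zB_f)\circ(zf)$. *)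

(* Defs.v *)
From HB Require Import structures.
From mathcomp Require Import all_boot all_order all_algebra.
From mathcomp Require Import all_classical all_reals.

Set Implicit Arguments.
Unset Strict Implicit.
Unset Printing Implicit Defensive.

Import Order.TTheory GRing.Theory Num.Theory.
Local Open Scope classical_set_scope.
Local Open Scope ring_scope.

Record fps (R : Type) := Fps { coefs :> nat -> R }.

Lemma fpsP (R : Type) (a b : fps R) : (forall n, a n = b n) <-> a = b.
Proof.
split=> [|-> //]; case: a b => [a] [b] /= ab.
by congr Fps; apply/funext.
Qed.

HB.instance Definition _ (R : Type) := gen_eqMixin (fps R).
HB.instance Definition _ (R : Type) := gen_choiceMixin (fps R).

Section Zmodule.
Variable R : zmodType.

Definition fps_zero : fps R := Fps (fun=> 0).
Definition fps_opp (a : fps R) : fps R := Fps (fun n => - a n).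
Definition fps_add (a b : fps R) : fps R := Fps (fun n => a n + b n).

Fact fps_addA : associative fps_add.
Proof. by move=> a b c; apply/fpsP => n /=; rewrite addrA. Qed.
Fact fps_addC : commutative fps_add.
Proof. by move=> a b; apply/fpsP => n /=; rewrite addrC. Qed.
Fact fps_add0 : left_id fps_zero fps_add.
Proof. by move=> a; apply/fpsP => n /=; rewrite add0r. Qed.
Fact fps_addN : left_inverse fps_zero fps_opp fps_add.
Proof. by move=> a; apply/fpsP => n /=; rewrite addNr. Qed.

HB.instance Definition _ :=
  GRing.isZmodule.Build (fps R) fps_addA fps_addC fps_add0 fps_addN.

Lemma fps0E n : (0 : fps R) n = 0. Proof. by []. Qed.
Lemma fpsNE (a : fps R) n : (- a) n = - a n. Proof. by []. Qed.
Lemma fpsDE (a b : fps R) n : (a + b) n = a n + b n. Proof. by []. Qed.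

Lemma fps_sumE (I : Type) (r : seq I) (P : pred I) (G : I -> fps R) n :
  (\sum_(i <- r | P i) G i) n = \sum_(i <- r | P i) G i n.
Proof. by elim/big_rec2: _ => // i y x _ <-. Qed.

End Zmodule.

Section Ring.
Variable R : comNzRingType.

Definition fps_one : fps R := Fps (fun n => (n == 0)%:R).
Definition fps_mul (a b : fps R) : fps R :=
  Fps (fun n => \sum_(j < n.+1) a j * b (n - j)%N).

Let trunc n (a : fps R) : {poly R} := \poly_(i < n) a i.

Let coef_truncM n k (a b : fps R) :
  (k < n)%N -> (trunc n a * trunc n b)`_k = fps_mul a b k.
Proof.
move=> kn; rewrite coefM; apply: eq_bigr => j _; rewrite !coef_poly.
by rewrite (leq_ltn_trans _ kn) ?leq_ord // (leq_ltn_trans _ kn) ?leq_subr.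
Qed.

Fact fps_mulC : commutative fps_mul.
Proof.
by move=> a b; apply/fpsP => n; rewrite -!(@coef_truncM n.+1) // mulrC.
Qed.

Fact fps_mulA : associative fps_mul.
Proof.
move=> a b c; apply/fpsP => n.
transitivity ((trunc n.+1 a * (trunc n.+1 b * trunc n.+1 c))`_n).
  rewrite coefM /=; apply: eq_bigr => j _.
  by rewrite coef_truncM ?ltnS ?leq_subr // coef_poly ltn_ord.
rewrite mulrA coefM /=; apply: eq_bigr => j _.
by rewrite coef_truncM // coef_poly ltnS leq_subr.
Qed.

Fact fps_mul1 : left_id fps_one fps_mul.
Proof.
move=> a; apply/fpsP => n /=; rewrite big_ord_recl /= mul1r subn0 big1 ?addr0 //.
by move=> i _; rewrite mul0r.
Qed.

Fact fps_mulDl : left_distributive fps_mul +%R.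
Proof.
move=> a b c; apply/fpsP => n; rewrite fpsDE /= -big_split /=.
by apply: eq_bigr => i _; rewrite mulrDl.
Qed.

Fact fps_one_neq0 : fps_one != 0.
Proof.
apply/eqP => /(congr1 (fun a : fps R => a 0%N)) /= /eqP.
by rewrite oner_eq0.
Qed.

HB.instance Definition _ := GRing.Zmodule_isComNzRing.Build (fps R)
  fps_mulA fps_mulC fps_mul1 fps_mulDl fps_one_neq0.

Lemma fps1E n : (1 : fps R) n = (n == 0)%:R. Proof. by []. Qed.
Lemma fpsME (a b : fps R) n :
  (a * b) n = \sum_(j < n.+1) a j * b (n - j)%N.
Proof. by []. Qed.

Lemma fps_exp_eq0 (a : fps R) k n : a 0%N = 0 -> (n < k)%N -> (a ^+ k) n = 0.
Proof.
move=> a0; elim: k n => // k IHk n nk; rewrite exprS fpsME big1 // => j _.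
have [->|j0] := posnP j; first by rewrite a0 mul0r.
rewrite IHk ?mulr0 // -ltnS; apply: leq_trans nk.
by rewrite ltnS ltn_subrL j0 (leq_trans j0) // -ltnS.
Qed.

Definition fpsC (c : R) : fps R := Fps (fun n => if n is 0%N then c else 0).

Lemma fpsCME (c : R) (a : fps R) n : (fpsC c * a) n = c * a n.
Proof.
rewrite fpsME big_ord_recl /= subn0 big1 ?addr0 // => i _.
by rewrite mul0r.
Qed.

Definition fpsX : fps R := Fps (fun n => (n == 1)%:R).

(* The coefficients of the infinite sum \sum_k a_k b^k, which makes sense for
   b of zero constant term only. The term b^k then contributes nothing in
   degree n < k, so that truncating the sum at k = n is exact. *)
Definition fps_comp (a b : fps R) : fps R :=
  Fps (fun n => \sum_(k < n.+1) a k * (b ^+ k) n).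

Lemma fps_comp_widen (a b : fps R) n N : b 0%N = 0 -> (n < N)%N ->
  fps_comp a b n = \sum_(k < N) a k * (b ^+ k) n.
Proof.
move=> b0 nN; rewrite /= (big_ord_widen N (fun k => a k * (b ^+ k) n)) //.
rewrite big_mkcond; apply: eq_bigr => k _ /=.
by case: ltnP => // nk; rewrite fps_exp_eq0 ?mulr0.
Qed.

(* a(z) / z, for a of zero constant term *)
Definition fps_divX (a : fps R) : fps R := Fps (fun n => a n.+1).

Definition fps_even (a : fps R) : Prop := forall n, odd n -> a n = 0.

(* a(sqrt z), for a even *)
Definition fps_sqrtX (a : fps R) : fps R := Fps (fun n => a n.*2).

(* The value is 0 when there is no compositional inverse. *)
Definition fps_compinv (a : fps R) : fps R :=
  xget 0 [set b : fps R |
    [/\ b 0%N = 0, fps_comp a b = fpsX & fps_comp b a = fpsX]].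

End Ring.

Arguments fpsX {R}.

Notation "a \So b" := (fps_comp a b) (at level 50) : ring_scope.

Section Inverse.
Variable F : fieldType.
Implicit Types a b : fps F.

Definition fps_unit : {pred fps F} := fun a => a 0%N != 0.

(* With u = 1 - a / a_0, the inverse of a is a_0^-1 * \sum_k u^k. *)
Definition fps_inv a : fps F :=
  if a 0%N == 0 then a
  else fpsC (a 0%N)^-1 * (Fps (fun=> 1) \So (1 - fpsC (a 0%N)^-1 * a)).

Fact fps_mulV : {in fps_unit, left_inverse 1 fps_inv *%R}.
Proof.
move=> a; rewrite unfold_in => a0; rewrite /fps_inv (negbTE a0).
set u := 1 - _; have u0 : u 0%N = 0.
  by rewrite fpsDE fpsNE fpsCME mulVf // subrr.
have aE c : fpsC (a 0%N)^-1 * c * a = c * (1 - u).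
  by rewrite /u subKr mulrCA mulrA.
rewrite aE.
apply/fpsP => n; transitivity ((1 - u ^+ n.+1 : fps F) n); last first.
  by rewrite fpsDE fpsNE fps_exp_eq0 // subr0.
rewrite -[1 in RHS](expr1n _ n.+1) subrXX mulrC !fpsME.
apply: eq_bigr => -[j jn] _; congr (_ * _).
rewrite (@fps_comp_widen _ _ _ _ n.+1) ?ltnS ?leq_subr // fps_sumE.
by apply: eq_bigr => i _; rewrite expr1n !mul1r.
Qed.

Fact fps_unitPl a b : b * a = 1 -> fps_unit a.
Proof.
move=> /(congr1 (fun c : fps F => c 0%N)).
rewrite fpsME big_ord1 fps1E eqxx /= => ba.
by apply/eqP => a0; move/eqP: ba; rewrite a0 mulr0 eq_sym oner_eq0.
Qed.

Fact fps_inv_out : {in [predC fps_unit], fps_inv =1 id}.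
Proof. by move=> a; rewrite inE unfold_in negbK /fps_inv => ->. Qed.

HB.instance Definition _ := GRing.ComNzRing_hasMulInverse.Build (fps F)
  fps_mulV fps_unitPl fps_inv_out.

Lemma fps_unitE a : (a \is a GRing.unit) = (a 0%N != 0).
Proof. by []. Qed.

End Inverse.

Section Riordan.
Variable R : realType.
Implicit Types a f g gamma B : fps R.

Definition fps_exp : fps R := Fps (fun n => n`!%:R^-1).

(* The square root with positive constant term; the value is 0 when there is
   no such square root. *)
Definition fps_sqrt a : fps R :=
  xget 0 [set b : fps R | 0 < b 0%N /\ b ^+ 2 = a].

(* gamma is the series gamma(1 + w) in w; this is gamma(a(z)), for a of
   constant term 1. *)
Definition eval_at1 gamma a : fps R := gamma \So (a - 1).

(* The Riordan array (g, f) is a pseudo-involution. *)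
Definition pseudo_involution g f : Prop :=
  [/\ g 0%N != 0, f 0%N = 0, f 1%N != 0,
      g \So (- f) = g^-1 & (- f) \So (- f) = fpsX].

Definition is_B_function f B : Prop :=
  f - fpsX = fpsX * f * (B \So (fpsX * f)).

End Riordan.

Arguments fps_exp {R}.

(* Main.v *)
Require Import Defs.
From HB Require Import structures.
From mathcomp Require Import all_boot all_order all_algebra.
From mathcomp Require Import all_classical all_reals.
From mathcomp Require Import ring.

(** Put [u = z gamma(g)], so that [g = e^u], and [G(z) = gamma(e^z)]. Then
[u = z G(u)], i.e. [u] is the compositional inverse of [P = z / G], and
[-f = P o (-z) o u] is a conjugate of the involution [-z]; this makes [(g, f)]
a pseudo-involution. Writing [f] and [z] as [u / G(-u)] and [u / G(u)],
[z f = v^2] for [v = u / eps(u)], and [f - z = z f E(u)]; since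
[u = inverse(z / eps) o v], the series [B] must satisfy [B(v^2) = h(v)], and
as [v] is invertible this means [B(z^2) = h(z)]. *)

Set Implicit Arguments.
Unset Strict Implicit.
Unset Printing Implicit Defensive.

Import Order.TTheory GRing.Theory Num.Theory.
Local Open Scope ring_scope.

(** * Coefficients of products, and fixed points of contracting maps *)

Section Coefficients.
Variable R : comNzRingType.
Implicit Types a b c : fps R.

Lemma fpsC_is_additive : zmod_morphism (@fpsC R).
Proof. by move=> x y; apply/fpsP => -[|n] //=; rewrite subr0. Qed.

Lemma fpsC_is_monoid_morphism : monoid_morphism (@fpsC R).
Proof.
split=> [|x y]; apply/fpsP => n; first by case: n.
by rewrite fpsCME; case: n => //= n; rewrite mulr0.
Qed.

HB.instance Definition _ :=
  GRing.isZmodMorphism.Build R (fps R) (@fpsC R) fpsC_is_additive.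
HB.instance Definition _ :=
  GRing.isMonoidMorphism.Build R (fps R) (@fpsC R) fpsC_is_monoid_morphism.

Lemma fpsM0 a b : (a * b) 0%N = a 0%N * b 0%N.
Proof. by rewrite fpsME big_ord_recl big_ord0 addr0. Qed.

Lemma fpsXM0 a : (fpsX * a) 0%N = 0.
Proof. by rewrite fpsM0 /= mul0r. Qed.

Lemma fpsXMS a n : (fpsX * a) n.+1 = a n.
Proof.
rewrite fpsME !big_ord_recl big1 => [|i _] /=; last by rewrite mul0r.
by rewrite subn1 mul0r mul1r add0r addr0.
Qed.

Lemma fpsX_regular a b : fpsX * a = fpsX * b -> a = b.
Proof.
by move=> ab; apply/fpsP => n; rewrite -(fpsXMS a) ab fpsXMS.
Qed.

Lemma fpsX_divX a : a 0%N = 0 -> fpsX * fps_divX a = a.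
Proof. by move=> a0; apply/fpsP => -[|n]; rewrite ?fpsXM0 ?fpsXMS. Qed.

Lemma fps_mul_congr a a' b b' n :
    (forall i, (i <= n)%N -> a i = a' i) ->
    (forall i, (i <= n)%N -> b i = b' i) ->
  (a * b) n = (a' * b') n.
Proof.
move=> aE bE; rewrite !fpsME; apply: eq_bigr => i _.
by rewrite aE ?leq_ord // bE ?leq_subr.
Qed.

Lemma fps_exp_congr a a' k n : (forall i, (i <= n)%N -> a i = a' i) ->
  (a ^+ k) n = (a' ^+ k) n.
Proof.
elim: k n => [|k IHk] n aE; first by rewrite !expr0.
rewrite !exprS; apply: fps_mul_congr => // i ni; apply: IHk => j ji.
by apply: aE; apply: leq_trans ni.
Qed.

Lemma fps_comp_congr a a' b b' n :
    (forall i, (i <= n)%N -> a i = a' i) ->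
    (forall i, (i <= n)%N -> b i = b' i) ->
  (a \So b) n = (a' \So b') n.
Proof.
move=> aE bE /=; apply: eq_bigr => k _; rewrite aE ?leq_ord //.
by congr (_ * _); apply: fps_exp_congr.
Qed.

(* A self-map whose n-th output coefficient depends only on the input
   coefficients of degree < n is contracting for the X-adic metric. *)
Lemma fps_fixpoint (F : fps R -> fps R) :
    (forall n a b, (forall i, (i < n)%N -> a i = b i) -> F a n = F b n) ->
  exists a, F a = a.
Proof.
move=> Fctr; pose s k := iter k F 0.
(* Each iteration settles one more coefficient, so coefficient [n] is stable from iterate [n.+1] on;
   the fixed point collects these stable values. *)
have sS k n : (n < k)%N -> s k.+1 n = s k n.
  elim: k n => // k IHk n nk; rewrite /s iterS [in RHS]iterS.
  by apply: Fctr => i ni; apply: IHk; apply: leq_trans ni _.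
have sE k n : (n < k)%N -> s k n = s n.+1 n.
  elim: k => // k IHk; rewrite ltnS leq_eqVlt => /orP[/eqP->//|nk].
  by rewrite sS // IHk.
exists (Fps (fun n => s n.+1 n)); apply/fpsP => n; rewrite [RHS]/=.
by apply: Fctr => i ni /=; rewrite -(sE n).
Qed.

End Coefficients.

(** * Composition: ring operations, associativity, substitution of -z and z^2 *)

Section Composition.
Variable R : comNzRingType.
Implicit Types a b c : fps R.

Lemma fps_comp0 a b : (a \So b) 0%N = a 0%N.
Proof. by rewrite /= big_ord1 expr0 mulr1. Qed.

Lemma fps_compD a b c : (a + b) \So c = (a \So c) + (b \So c).
Proof.
apply/fpsP => n; rewrite /= -big_split /=; apply: eq_bigr => k _.
by rewrite mulrDl.
Qed.

Lemma fps_compN a c : (- a) \So c = - (a \So c).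
Proof.
apply/fpsP => n; rewrite /= -sumrN; apply: eq_bigr => k _.
by rewrite mulNr.
Qed.

Lemma fps_compB a b c : (a - b) \So c = (a \So c) - (b \So c).
Proof. by rewrite fps_compD fps_compN. Qed.

Lemma fps_compC x c : fpsC x \So c = fpsC x.
Proof.
apply/fpsP => n; rewrite [LHS]big_ord_recl big1 => [|k _]; last by rewrite mul0r.
by case: n => [|n]; rewrite expr0 fps1E ?mulr1 ?mulr0 addr0.
Qed.

Lemma fps_comp1 c : 1 \So c = 1.
Proof. by rewrite -(rmorph1 (@fpsC R)) fps_compC. Qed.

Lemma fps_comp_sum (I : Type) (r : seq I) (P : pred I) (G : I -> fps R) c :
  (\sum_(i <- r | P i) G i) \So c = \sum_(i <- r | P i) (G i \So c).
Proof.
elim/big_rec2: _ => [|i y x _ <-]; last by rewrite fps_compD.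
by apply/fpsP => n; rewrite /= big1 // => k _; rewrite mul0r.
Qed.

Lemma fps_comp_poly a b n N : b 0%N = 0 -> (n < N)%N ->
  (a \So b) n = (\sum_(k < N) fpsC (a k) * b ^+ k) n.
Proof.
move=> b0 nN; rewrite (fps_comp_widen a b0 nN) fps_sumE.
by apply: eq_bigr => k _; rewrite fpsCME.
Qed.

Let eval c (p : {poly R}) := (map_poly (@fpsC R) p).[c].

(** Up to a given degree, composition is polynomial evaluation, which is a ring morphism in [p].
    Coefficients of [p] beyond [n] are harmless because [c ^+ i] vanishes below degree [i]. *)
Let comp_eval a c (p : {poly R}) n : c 0%N = 0 ->
  (forall k, (k <= n)%N -> p`_k = a k) -> (a \So c) n = eval c p n.
Proof.
(* The bound must cover all of [p] for the evaluation and exceed [n] for the composition. *)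
move=> c0 pE; rewrite /eval (@horner_coef_wide _ (maxn n.+1 (size p))); last first.
  by rewrite (leq_trans (size_poly _ _)) ?leq_maxr.
rewrite fps_sumE; transitivity (\sum_(i < maxn n.+1 (size p)) p`_i * (c ^+ i) n).
  transitivity ((Fps (fun k => p`_k) \So c) n).
    by apply: fps_comp_congr => // i ni; rewrite -pE.
  by apply: fps_comp_widen; rewrite // leq_maxl.
by apply: eq_bigr => i _; rewrite coef_map fpsCME.
Qed.

Lemma fps_compM a b c : c 0%N = 0 -> (a * b) \So c = (a \So c) * (b \So c).
Proof.
move=> c0; apply/fpsP => n.
pose T (d : fps R) : {poly R} := \poly_(i < n.+1) d i.
have TE d k : (k <= n)%N -> (T d)`_k = d k by rewrite coef_poly ltnS => ->.
(* [T a * T b] need not be a truncation of [a * b], but the two agree up to degree [n]. *)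
rewrite (@comp_eval _ _ (T a * T b)) //; last first.
  move=> k kn; rewrite coefM fpsME; apply: eq_bigr => i _.
  rewrite !TE ?(leq_trans (leq_subr _ _)) //.
  by apply: leq_trans kn; rewrite -ltnS.
rewrite /eval rmorphM hornerM; apply: fps_mul_congr => i ni.
  by rewrite -(@comp_eval a) // => k ki; rewrite TE ?(leq_trans ki).
by rewrite -(@comp_eval b) // => k ki; rewrite TE ?(leq_trans ki).
Qed.

Lemma fps_compXn a c k : c 0%N = 0 -> (a ^+ k) \So c = (a \So c) ^+ k.
Proof.
move=> c0; elim: k => [|k IHk]; first by rewrite !expr0 fps_comp1.
by rewrite !exprS fps_compM // IHk.
Qed.

(** Coefficient [n] involves only a finite combination of powers of [b], and substituting [c]
    commutes with sums and powers. *)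
Lemma fps_compA a b c : b 0%N = 0 -> c 0%N = 0 ->
  a \So (b \So c) = (a \So b) \So c.
Proof.
move=> b0 c0; apply/fpsP => n.
have bc0 : (b \So c) 0%N = 0 by rewrite fps_comp0.
rewrite (@fps_comp_poly _ _ _ n.+1) //.
have -> : ((a \So b) \So c) n
        = ((\sum_(k < n.+1) fpsC (a k) * b ^+ k) \So c) n.
  by apply: fps_comp_congr => // i ni; rewrite (@fps_comp_poly _ _ _ n.+1).
rewrite fps_comp_sum; congr (coefs _ n); apply: eq_bigr => k _.
by rewrite fps_compM // fps_compC fps_compXn.
Qed.

Lemma fps_compX c : c 0%N = 0 -> fpsX \So c = c.
Proof.
move=> c0; apply/fpsP => n; rewrite (@fps_comp_widen _ _ _ _ n.+2) //.
rewrite !big_ord_recl big1 => [|i _] /=; last by rewrite mul0r.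
by rewrite mul0r mul1r add0r addr0 expr1.
Qed.

Lemma fps_compXr a : a \So fpsX = a.
Proof.
have XnE k n : (fpsX ^+ k : fps R) n = (n == k)%:R.
  elim: k n => [|k IHk] n; first by rewrite expr0.
  by case: n => [|n]; rewrite exprS ?fpsXM0 // fpsXMS IHk.
apply/fpsP => n; rewrite /= big_ord_recr /= XnE eqxx mulr1 big1 ?add0r // => k _.
by rewrite XnE gtn_eqF ?mulr0.
Qed.

Lemma fps_compNX a n : (a \So (- fpsX)) n = (-1) ^+ n * a n.
Proof.
have NXnE k m : ((- fpsX) ^+ k : fps R) m = (-1) ^+ k * (m == k)%:R.
  elim: k m => [|k IHk] m; first by rewrite !expr0 mul1r.
  rewrite exprS mulNr fpsNE exprS; case: m => [|m].
    by rewrite fpsXM0 mulr0 oppr0.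
  by rewrite fpsXMS IHk mulN1r mulNr.
rewrite /= big_ord_recr /= NXnE eqxx mulr1 mulrC big1 ?add0r // => k _.
by rewrite NXnE gtn_eqF ?mulr0.
Qed.

Lemma fps_comp_sqrX a n : (a \So (fpsX ^+ 2)) n = if odd n then 0 else a n./2.
Proof.
have XnE k m : ((fpsX ^+ 2) ^+ k : fps R) m = (m == k.*2)%:R.
  elim: k m => [|k IHk] m; first by rewrite expr0.
  rewrite exprS expr2 -mulrA; case: m => [|[|m]]; rewrite ?fpsXM0 // fpsXMS.
    by rewrite fpsXM0.
  by rewrite fpsXMS IHk.
have X0 : (fpsX ^+ 2 : fps R) 0%N = 0 by rewrite expr2 fpsXM0.
have [nodd|neven] := boolP (odd n).
  rewrite /= big1 // => k _; rewrite XnE; case: eqP => [nE|_]; last exact: mulr0.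
  by have := nodd; rewrite [X in odd X]nE odd_double.
have nE : n = n./2.*2 by rewrite even_halfK.
have hn : (n./2 < n.+1)%N by rewrite {2}nE -addnn ltnS leq_addr.
rewrite /= (bigD1 (Ordinal hn)) //= XnE -nE eqxx mulr1 big1 ?addr0 // => k kn.
rewrite XnE; case: eqP => [nk|_]; last exact: mulr0.
by case/eqP: kn; apply: val_inj; rewrite /= [X in X./2]nk doubleK.
Qed.

Lemma fps_evenP (a : fps R) : fps_even a -> a = fps_sqrtX a \So (fpsX ^+ 2).
Proof.
move=> aeven; apply/fpsP => n; rewrite fps_comp_sqrX.
by case: ifPn => [/aeven//|nodd] /=; rewrite even_halfK.
Qed.

Lemma fps_sqrtXK a : fps_sqrtX (a \So (fpsX ^+ 2)) = a.
Proof.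
by apply/fpsP => n; rewrite [LHS]fps_comp_sqrX odd_double doubleK.
Qed.

End Composition.

(* Otherwise conversion tests on series unfold them to coefficient sums. *)
Local Opaque fps_comp fps_mul fps_add fps_opp fps_inv.

(** * Multiplicative and compositional inverses *)

Section Inverses.
Variable F : fieldType.
Implicit Types a c w : fps F.

(** Composition keeps the constant term, so [a] and [a \So c] are units together; on non-units
    inversion is the identity. *)
Lemma fps_compV a c : c 0%N = 0 -> a^-1 \So c = (a \So c)^-1.
Proof.
move=> c0; have [aU|aNU] := boolP (a \is a GRing.unit).
  have acU : a \So c \is a GRing.unit by rewrite fps_unitE fps_comp0.
  by apply: (mulrI acU); rewrite -fps_compM // !divrr // fps_comp1.
by rewrite !invr_out // fps_unitE fps_comp0 -fps_unitE.
Qed.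

Lemma fps_inv0 a : (a^-1) 0%N = (a 0%N)^-1.
Proof.
have [aU|aNU] := boolP (a \is a GRing.unit).
  have a0 : a 0%N != 0 by rewrite -fps_unitE.
  by apply: (mulfI a0); rewrite -fpsM0 divrr // mulfV.
(* A non-unit is its own inverse and 0 inverts to 0, so both sides vanish. *)
by move: (aNU); rewrite invr_out // fps_unitE negbK => /eqP ->; rewrite invr0.
Qed.

(** The inverse [b] of z w must satisfy b = z / w(b), a contracting fixed-point equation. The form
    [fpsX * t] of the result allows the lemma to be applied again to the inverse itself. *)
Lemma fps_comp_rinv w : w 0%N != 0 ->
  exists2 t : fps F, t 0%N != 0 & (fpsX * w) \So (fpsX * t) = fpsX.
Proof.
move=> w0; have [b bE] : exists b, fpsX * (w^-1 \So b) = b.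
  apply: (@fps_fixpoint F (fun b => fpsX * (w^-1 \So b))) => -[|n] a b ab.
    by rewrite [LHS]fpsXM0 [RHS]fpsXM0.
  by rewrite [LHS]fpsXMS [RHS]fpsXMS; apply: fps_comp_congr.
have b0 : b 0%N = 0 by rewrite -bE fpsXM0.
exists (w^-1 \So b); first by rewrite fps_comp0 fps_inv0 invr_eq0.
rewrite bE fps_compM // fps_compX // -{1}bE fps_compV // -mulrA mulVr ?mulr1 //.
by rewrite fps_unitE fps_comp0.
Qed.

Lemma fps_compinvP w (b := fps_compinv (fpsX * w)) : w 0%N != 0 ->
  [/\ b 0%N = 0, (fpsX * w) \So b = fpsX & b \So (fpsX * w) = fpsX].
Proof.
move=> w0; apply: (@xgetPex _ 0 [set b : fps F |
  [/\ b 0%N = 0, (fpsX * w) \So b = fpsX & b \So (fpsX * w) = fpsX]]%classic).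
(* The right inverse has a right inverse in turn, which associativity identifies with [fpsX * w];
   hence the inverse is two-sided. *)
have [t t0 wt] := fps_comp_rinv w0; have [s s0 ts] := fps_comp_rinv t0.
exists (fpsX * t); split=> //; first exact: fpsXM0.
suff -> : fpsX * w = fpsX * s by [].
rewrite -[LHS]fps_compXr -[X in _ \So X = _]ts fps_compA ?fpsXM0 // wt.
by rewrite fps_compX ?fpsXM0.
Qed.

Lemma fps_comp_linv w (u : fps F) : w 0%N != 0 -> u 0%N = 0 ->
  (fpsX * w) \So u = fpsX -> u \So (fpsX * w) = fpsX.
Proof.
move=> w0 u0 wu; have [b0 wb bw] := fps_compinvP w0.
suff -> : u = fps_compinv (fpsX * w) by [].
rewrite -[LHS]fps_compX // -[X in X \So _ = _]bw -fps_compA ?fpsXM0 // wu.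
exact: fps_compXr.
Qed.

End Inverses.

(** * Even series, square roots and the exponential *)

Section Parity.
Variable R : realType.
Implicit Types a b : fps R.

Lemma fps_even_compNX a : a \So (- fpsX) = a -> fps_even a.
Proof.
move=> aE n nodd; have : (a \So (- fpsX)) n = a n by rewrite aE.
rewrite fps_compNX -signr_odd nodd mulN1r.
by move/eqP; rewrite eq_sym -subr_eq0 opprK -mulr2n mulrn_eq0 /= => /eqP.
Qed.

(** In (a - b)(a + b) = 0 the second factor is a unit, its constant term being positive. *)
Lemma fps_sqrt_inj a b : 0 < a 0%N -> 0 < b 0%N -> a ^+ 2 = b ^+ 2 -> a = b.
Proof.
move=> a0 b0 ab; have abU : a + b \is a GRing.unit.
  by rewrite fps_unitE fpsDE gt_eqF // addr_gt0.
by apply/subr0_eq/(mulIr abU); rewrite -subr_sqr ab subrr mul0r.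
Qed.

Lemma fps_sqrtP a : 0 < a 0%N -> 0 < fps_sqrt a 0%N /\ fps_sqrt a ^+ 2 = a.
Proof.
move=> a0; apply: (@xgetPex _ 0 [set b : fps R | 0 < b 0%N /\ b ^+ 2 = a]%classic).
pose r := Num.sqrt (a 0%N); have r0 : 0 < r by rewrite sqrtr_gt0.
pose q := fps_divX (a - fpsC (a 0%N)).
(* With a = r^2 + z q, the root r + z t requires 2 r t + z t^2 = q; solved for the linear term, this
   is contracting in [t]. *)
have [t tE] : exists t, fpsC (2 * r)^-1 * (q - fpsX * t ^+ 2) = t.
  apply: fps_fixpoint => n b c bc; rewrite !fpsCME !fpsDE !fpsNE.
  case: n bc => [|n] bc; first by rewrite !fpsXM0.
  by rewrite !fpsXMS (@fps_exp_congr _ b c).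
exists (fpsC r + fpsX * t); split; first by rewrite fpsDE fpsXM0 addr0.
have tE2 : fpsC (2 * r) * t = q - fpsX * t ^+ 2.
  rewrite -{1}tE mulrA -rmorphM mulfV ?rmorph1 ?mul1r //.
  by rewrite mulf_neq0 ?pnatr_eq0 // gt_eqF.
have aE : a = fpsC r ^+ 2 + fpsX * q.
  by rewrite -rmorphXn /= sqr_sqrtr ?ltW // fpsX_divX ?subrKC // fpsDE fpsNE subrr.
have qE : q = fpsC (2 * r) * t + fpsX * t ^+ 2 by rewrite tE2 subrK.
by rewrite [RHS]aE qE rmorphM rmorph_nat /=; ring.
Qed.

Lemma fps_exp0 : (fps_exp : fps R) 0%N = 1.
Proof. by rewrite /= invr1. Qed.

Lemma fps_exp_compNX : fps_exp \So (- fpsX) = fps_exp^-1 :> fps R.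
Proof.
have eU : (fps_exp : fps R) \is a GRing.unit.
  by rewrite fps_unitE /= invr_eq0 oner_eq0.
apply: (mulrI eU); rewrite divrr //; apply/fpsP => n.
have fact0 k : (k`!%:R : R) != 0 by rewrite pnatr_eq0 -lt0n fact_gt0.
(* The Cauchy product is a binomial expansion; [addrC] puts the exponent n - j on the sign, as in
   the product. *)
have -> : (fps_exp * (fps_exp \So (- fpsX))) n = n`!%:R^-1 * (1 - 1 : R) ^+ n.
  rewrite fpsME addrC exprDn mulr_sumr; apply: eq_bigr => -[j jn] _.
  rewrite fps_compNX /= expr1n mulr1; rewrite ltnS in jn; rewrite -(bin_fact jn) !natrM.
  rewrite -[X in _ = _ * X]mulr_natr.
  have bn0 : ('C(n, j)%:R : R) != 0 by rewrite pnatr_eq0 -lt0n bin_gt0.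
  by field; rewrite !fact0 bn0.
by rewrite subrr expr0n fps1E; case: n => [|n]; rewrite ?mulr0 // mulr1 invr1.
Qed.

End Parity.

(** * Compatibility of substitutions with gamma and with square roots *)

Lemma eval_at1_comp (R : realType) (gamma a c : fps R) :
    a 0%N = 1 -> c 0%N = 0 ->
  eval_at1 gamma (a \So c) = eval_at1 gamma a \So c.
Proof.
move=> a0 c0; rewrite /eval_at1 -{1}(fps_comp1 c) -fps_compB fps_compA //.
by rewrite fpsDE fpsNE a0 subrr.
Qed.

Lemma eval_at10 (R : realType) (gamma a : fps R) :
  (eval_at1 gamma a) 0%N = gamma 0%N.
Proof. exact: fps_comp0. Qed.

Lemma fps_compNX_inv (R : comNzRingType) (a : fps R) :
  a \So (- fpsX) \So (- fpsX) = a.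
Proof.
have NX0 : (- fpsX : fps R) 0%N = 0 by rewrite fpsNE oppr0.
by rewrite -fps_compA // fps_compN fps_compX // opprK fps_compXr.
Qed.

Lemma fps_compNl (R : comNzRingType) (c : fps R) :
  c 0%N = 0 -> (- fpsX) \So c = - c.
Proof. by move=> c0; rewrite fps_compN fps_compX. Qed.

(** Substituting -z in the root gives another root of [a] with the same positive constant term, so
    uniqueness applies. *)
Lemma fps_sqrt_compNX (R : realType) (a : fps R) :
  0 < a 0%N -> a \So (- fpsX) = a -> fps_sqrt a \So (- fpsX) = fps_sqrt a.
Proof.
move=> a0 aE; have [s0 sE] := fps_sqrtP a0; move: (fps_sqrt a) s0 sE => s s0 sE.
have NX0 : (- fpsX : fps R) 0%N = 0 by rewrite fpsNE oppr0.
have s0' : 0 < (s \So (- fpsX)) 0%N by rewrite fps_comp0.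
by apply: (fps_sqrt_inj s0' s0); rewrite -(fps_compXn _ _ NX0) sE aE.
Qed.

(** * The companion [f]: conjugacy to -z, and its B-function *)

(* [G] and [GN] stand for gamma(e^z) and gamma(e^-z), [u] for log g, and [b] for
   the compositional inverse of z / eps. *)
Section Companion.
Variable R : realType.
Variables G GN eps E u f b : fps R.
Hypothesis G0 : G 0%N != 0.
Hypothesis GcompNX : G \So (- fpsX) = GN.
Hypothesis epsE : eps ^+ 2 = G * GN.
Hypothesis eps_compNX : eps \So (- fpsX) = eps.
Hypothesis XE : fpsX * E = G - GN.
Hypothesis u0 : u 0%N = 0.
Hypothesis uE : u = fpsX * (G \So u).
Hypothesis fE : f = fpsX * ((G \So u) / (GN \So u)).
Hypothesis b0 : b 0%N = 0.
Hypothesis epsb : (fpsX / eps) \So b = fpsX.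
Hypothesis beps : b \So (fpsX / eps) = fpsX.

Let NX0 : (- fpsX : fps R) 0%N = 0. Proof. by rewrite fpsNE oppr0. Qed.
Let Nu0 : (- u) 0%N = 0. Proof. by rewrite fpsNE u0 oppr0. Qed.
Let Nb0 : (- b) 0%N = 0. Proof. by rewrite fpsNE b0 oppr0. Qed.
Let XG0 : (fpsX / G) 0%N = 0. Proof. exact: fpsXM0. Qed.
Let Xeps0 : (fpsX / eps) 0%N = 0. Proof. exact: fpsXM0. Qed.

Let Gu_unit : G \So u \is a GRing.unit.
Proof. by rewrite fps_unitE fps_comp0. Qed.

Let GNu_unit : GN \So u \is a GRing.unit.
Proof. by rewrite fps_unitE fps_comp0 -GcompNX fps_comp0. Qed.

Let GNcompNX : GN \So (- fpsX) = G.
Proof. by rewrite -GcompNX fps_compNX_inv. Qed.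

Let GcompNu : G \So (- u) = GN \So u.
Proof. by rewrite -GcompNX -(fps_compA G NX0 u0) fps_compNl. Qed.

Let f_def : f = u / (GN \So u).
Proof. by rewrite fE mulrA -uE. Qed.

Let Gu : (fpsX / G) \So u = fpsX.
Proof.
rewrite (fps_compM _ _ u0) (fps_compX u0) (fps_compV _ u0).
by rewrite [X in X / _]uE (mulrK Gu_unit).
Qed.

Let uG : u \So (fpsX / G) = fpsX.
Proof. by apply: (fps_comp_linv _ u0 Gu); rewrite fps_inv0 invr_eq0. Qed.

Lemma companion_conj : - f = (fpsX / G) \So (- u).
Proof.
by rewrite (fps_compM _ _ Nu0) (fps_compX Nu0) (fps_compV _ Nu0) GcompNu f_def mulNr.
Qed.

(** Since [u] inverts z / G, it conjugates [- f] to -z. For g = e^u this is the identity g(-f) =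
    1/g. *)
Lemma companion_comp : u \So (- f) = - u.
Proof. by rewrite companion_conj (fps_compA _ XG0 Nu0) uG (fps_compX Nu0). Qed.

Lemma companion0 : f 0%N = 0.
Proof. by rewrite fE; apply: fpsXM0. Qed.

Lemma companion1 : f 1%N != 0.
Proof.
by rewrite fE fpsXMS -fps_unitE unitrM unitrV Gu_unit GNu_unit.
Qed.

Lemma companion_involution : (- f) \So (- f) = fpsX.
Proof.
have Nf0 : (- f) 0%N = 0 by rewrite fpsNE companion0 oppr0.
rewrite {1}companion_conj -(fps_compA _ Nu0 Nf0) fps_compN companion_comp.
by rewrite opprK Gu.
Qed.

(** The series [G - GN] is odd, and cancelling the odd factor [fpsX] leaves an even one. *)
Let E_compNX : E \So (- fpsX) = E.
Proof.
have XEN := fps_compM fpsX E NX0.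
rewrite (fps_compX NX0) XE fps_compB GcompNX GNcompNX mulNr in XEN.
by apply: fpsX_regular; rewrite XE -[LHS]opprK -XEN opprB.
Qed.

(** As [eps] is even, z / eps is odd, hence so is its inverse [b]; an even series of an odd one is
    even. *)
Lemma companion_B_compNX : (E \So b) \So (- fpsX) = E \So b.
Proof.
have eps_odd : (fpsX / eps) \So (- fpsX) = - (fpsX / eps).
  by rewrite (fps_compM _ _ NX0) (fps_compX NX0) (fps_compV _ NX0) eps_compNX mulNr.
have NbE : (- fpsX) \So b = - b by rewrite fps_compNl.
have epsNb : (fpsX / eps) \So (- b) = - fpsX.
  by rewrite -NbE (fps_compA _ NX0 b0) eps_odd fps_compN epsb.
have b_odd : b \So (- fpsX) = - b.
  by rewrite -epsNb (fps_compA _ Xeps0 Nb0) beps (fps_compX Nb0).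
by rewrite -(fps_compA _ b0 NX0) b_odd -NbE (fps_compA _ NX0 b0) E_compNX.
Qed.

Let v := (fpsX / eps) \So u.

Let v0 : v 0%N = 0. Proof. by rewrite fps_comp0. Qed.

Let bv : b \So v = u.
Proof. by rewrite (fps_compA _ Xeps0 u0) beps (fps_compX u0). Qed.

(** A right inverse of [v] is what allows [v] to be cancelled from a(v) = c(v). *)
Let v_rinv : v \So ((fpsX / G) \So b) = fpsX.
Proof.
have XGb0 : ((fpsX / G) \So b) 0%N = 0 by rewrite fps_comp0.
rewrite -(fps_compA _ u0 XGb0) (fps_compA _ XG0 b0) uG (fps_compX b0).
exact: epsb.
Qed.

Let X_def : fpsX = u / (G \So u).
Proof. by rewrite [X in X / _]uE (mulrK Gu_unit). Qed.

Let Xf_v2 : fpsX * f = v ^+ 2.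
Proof.
have epsu : (eps \So u) ^+ 2 = (G \So u) * (GN \So u).
  by rewrite -(fps_compXn _ _ u0) epsE (fps_compM _ _ u0).
rewrite /v (fps_compM _ _ u0) (fps_compX u0) (fps_compV _ u0) exprMn exprVn epsu.
rewrite (invrM Gu_unit GNu_unit) f_def [X in X * _ = _]X_def.
have swap (x y z : fps R) : x * y * (x * z) = x ^+ 2 * (z * y).
  by rewrite mulrACA expr2 [y * z]mulrC.
exact: swap.
Qed.

(** The difference of u / GN(u) and u / G(u) has numerator u (G(u) - GN(u)), which is u^2 E(u), over
    G(u) GN(u). *)
Lemma companion_B : f - fpsX = fpsX * f * (E \So u).
Proof.
have uEu : u * (E \So u) = (G \So u) - (GN \So u).
  by rewrite -fps_compB -XE (fps_compM _ _ u0) (fps_compX u0).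
rewrite -mulrA f_def [u / _ * _]mulrAC uEu [X in _ = X * _]X_def [X in _ - X]X_def.
rewrite mulrBl (divrr GNu_unit) mulrBr mulr1.
by rewrite -!mulrA [(G \So u)^-1 * _]mulrA (mulVr Gu_unit) mul1r.
Qed.

(** The factor z f is z^2 times a unit. *)
Let Xf_inj (a c : fps R) : fpsX * f * a = fpsX * f * c -> a = c.
Proof.
have wU : (G \So u) / (GN \So u) \is a GRing.unit.
  by rewrite unitrM unitrV Gu_unit GNu_unit.
rewrite fE; move: (_ / _) wU => w wU.
by rewrite -!mulrA => /fpsX_regular/fpsX_regular/(mulrI wU).
Qed.

Lemma companion_is_B_function (B : fps R) :
  is_B_function f B <-> B \So (fpsX ^+ 2) = E \So b.
Proof.
have XX0 : (fpsX ^+ 2 : fps R) 0%N = 0 by rewrite expr2; apply: fpsXM0.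
have BE : B \So (fpsX * f) = (B \So (fpsX ^+ 2)) \So v.
  by rewrite -(fps_compA _ XX0 v0) (fps_compXn _ _ v0) (fps_compX v0) Xf_v2.
have Ev : (E \So b) \So v = E \So u by rewrite -(fps_compA _ b0 v0) bv.
split=> [fB|EB]; last first.
  by rewrite /is_B_function BE EB Ev; exact: companion_B.
have /Xf_inj vv := etrans (esym companion_B) fB.
rewrite BE -Ev in vv.
have c0 : ((fpsX / G) \So b) 0%N = 0 by rewrite fps_comp0.
have vK : cancel (fun a : fps R => a \So v) (fun a => a \So ((fpsX / G) \So b)).
  by move=> a; rewrite -(fps_compA a v0 c0) v_rinv fps_compXr.
exact: (can_inj vK (esym vv)).
Qed.

End Companion.

(** [fps_sqrtX] reads only the coefficients of even index, so evenness of [h] is what makes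
    [fps_sqrtX h] the substitution of sqrt z. The equivalence gives both existence and uniqueness of
    the B-function. *)
Theorem theorem4p3 (R : realType) (gamma g f : fps R)
    (gamma_neq0 : gamma 0%N <> 0) (* gamma is the expansion of gamma(1 + w) *)
    (g0 : g 0%N = 1)
    (gE : g = fps_exp \So (fpsX * eval_at1 gamma g))
    (fE : f = fpsX * (eval_at1 gamma g / eval_at1 gamma g^-1)) :
  let gamma_exp := eval_at1 gamma fps_exp in
  let gamma_expN := eval_at1 gamma (fps_exp \So (- fpsX)) in
  let eps := fps_sqrt (gamma_exp * gamma_expN) in
  let E := fps_divX (gamma_exp - gamma_expN) in
  let h := E \So fps_compinv (fpsX / eps) in
  [/\ pseudo_involution g f,
      fps_even h
    & forall B : fps R, is_B_function f B <-> B = fps_sqrtX h].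
Proof.
move=> G GN eps E h.
have NX0 : (- fpsX : fps R) 0%N = 0 by rewrite fpsNE oppr0.
have GcompNX : G \So (- fpsX) = GN.
  by rewrite /G /GN (eval_at1_comp gamma (fps_exp0 R) NX0).
have G0 : G 0%N != 0 by rewrite eval_at10; apply/eqP.
have GGN0 : 0 < (G * GN) 0%N.
  by rewrite fpsM0 !eval_at10 -expr2 lt0r sqr_ge0 andbT sqrf_eq0; apply/eqP.
have [eps0 epsE] := fps_sqrtP GGN0; rewrite -/eps in eps0 epsE.
(* [u] plays the role of log g and is kept opaque; rewriting gamma(g) as G(u) later turns its
   equation into u = z G(u). *)
have [u uE] : exists u, u = fpsX * eval_at1 gamma g.
  exists (fpsX * eval_at1 gamma g); exact: erefl.
have u0 : u 0%N = 0 by rewrite uE; apply: fpsXM0.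
rewrite -uE in gE.
have gu : eval_at1 gamma g = G \So u.
  by rewrite gE (eval_at1_comp gamma (fps_exp0 R) u0).
have Nu0 : (- u) 0%N = 0 by rewrite fpsNE u0 oppr0.
have gVE : g^-1 = fps_exp \So (- u).
  by rewrite gE -(fps_compV _ u0) -fps_exp_compNX -(fps_compA _ NX0 u0) fps_compNl.
have gVu : eval_at1 gamma g^-1 = GN \So u.
  rewrite gVE (eval_at1_comp gamma (fps_exp0 R) Nu0) -/G.
  by rewrite -GcompNX -(fps_compA G NX0 u0) (fps_compNl u0).
rewrite gu in uE; rewrite gu gVu in fE.
have XE : fpsX * E = G - GN.
  by apply: fpsX_divX; rewrite fpsDE fpsNE !eval_at10 subrr.
have GNcompNX : GN \So (- fpsX) = G by rewrite -GcompNX; exact: fps_compNX_inv.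
have eps_compNX : eps \So (- fpsX) = eps.
  apply: (fps_sqrt_compNX GGN0); rewrite (fps_compM _ _ NX0) GcompNX GNcompNX.
  exact: mulrC.
have [] := @fps_compinvP _ eps^-1; first by rewrite fps_inv0 invr_eq0 gt_eqF.
rewrite /h; set b := fps_compinv (fpsX / eps) => b0 epsb beps.
have h_even : fps_even (E \So b).
  apply: fps_even_compNX.
  exact: (companion_B_compNX GcompNX eps_compNX XE b0 epsb beps).
split; [split| exact: h_even |].
- by rewrite g0 oner_eq0.
- exact: (companion0 fE).
- exact: (companion1 G0 GcompNX fE).
- have Nf0 : (- f) 0%N = 0 by rewrite fpsNE (companion0 fE) oppr0.
  rewrite gVE [X in X \So _]gE -(fps_compA _ u0 Nf0).
  by congr (_ \So _); exact: (companion_comp G0 GcompNX u0 uE fE).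
- exact: (companion_involution G0 GcompNX u0 uE fE).
- have BP := companion_is_B_function G0 GcompNX epsE XE u0 uE fE b0 epsb beps.
  move=> B; split=> [/BP BE|BE].
    by rewrite -BE fps_sqrtXK.
  by apply/BP; rewrite BE; exact: (esym (fps_evenP h_even)).
Qed.
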